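(* Let $p$ be a prime and let $G$ be a non-abelian finite $p$-group. (1) Suppose $|G|=p^{m+n}$ for integers $1\le n<m$, that $G$ is not isomorphic to the quaternion group of order $8$, and that $G$ contains an element of order $p^m$. Then $G$ satisfies $\mathcal P(p)$. (2) Suppose $G$ contains an element of order at least $\max(p^2,8)$, and let $\alpha$ be an element of order $p$ in the center $\mathcal Z(G)$. Then either $G$ satisfies $\mathcal P(p)$, or $G/\langle\alpha\rangle$ satisfies $\mathcal P(p)$. Consequently, $G\times(G/\langle\alpha\rangle)$ satisfies $\mathcal P(p)$.
   Context: For a finite group $\Gamma$, $\ell\ge1$ and $x\in\Gamma$, $r_\ell(x)=|\{g\in\Gamma:g^\ell=x\}|$. $\Gamma$ satisfies $\mathcal P(p)$ if there exist $a,b\in\Gamma$ of the same order with $0=r_p(a)<r_p(b)$ and $r_\ell(a)=r_\ell(b)$ for every square-free integer $1<\ell<p$. *)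

(* Defs.v *)
From mathcomp Require Import all_boot all_fingroup all_solvable.

Set Implicit Arguments.
Unset Strict Implicit.
Unset Printing Implicit Defensive.

Import GroupScope.

Definition squarefree (n : nat) : Prop :=
  forall d : nat, (d ^ 2 %| n)%N -> d = 1%N.

Definition nroots (gT : finGroupType) (G : {group gT}) (l : nat) (x : gT) : nat :=
  #|[set g in G | g ^+ l == x]|.

Definition satisfiesP (gT : finGroupType) (G : {group gT}) (p : nat) : Prop :=
  exists a b : gT,
    [/\ a \in G, b \in G, #[a] = #[b],
        nroots G p a = 0%N /\ (0 < nroots G p b)%N
      & forall l : nat, (1 < l < p)%N -> squarefree l ->
          nroots G l a = nroots G l b].

(* Main.v *)
Require Import Defs.
From mathcomp Require Import all_boot all_fingroup all_solvable.

Set Implicit Arguments.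
Unset Strict Implicit.
Unset Printing Implicit Defensive.

Import GroupScope.

(** In a p-group only p-th roots matter, so a p-group fails P(p) exactly when
    every element lies in a cyclic subgroup of maximal order p^e, the exponent.
    If moreover all cyclic subgroups of order p^e meet in the same subgroup of
    order p, then it is the only one, so the non-abelian G is quaternion, and only
    Q_8 fails P(2).  In (1) this happens by counting, since two cyclic subgroups
    of order p^e >= p^m cannot meet trivially in G.  In (2), either all cyclic
    subgroups of order p^e contain alpha, or some <y> does not; then in
    G / <alpha> the image of y still has order p^e, so its p-th power has order
    p^(e-1), as does the image of a generator b of a cyclic subgroup of order p^e
    containing alpha; but the image of b is not a p-th power, since G has no
    element of order p^(e+1). *)

Section PrimePower.

Variable p : nat.
Hypothesis p_pr : prime p.

(* For l < p, x |-> x^l is a bijection of a p-group, so nroots G l is constantly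
   1 and only the conditions on p-th roots in satisfiesP matter. *)
Lemma satisfiesP_iff (gT : finGroupType) (G : {group gT}) :
    p.-group G ->
  satisfiesP G p <-> exists a c : gT,
    [/\ a \in G, c \in G, #[a] = #[c ^+ p] & {in G, forall g, g ^+ p != a}].
Proof.
move=> pG; split=> [[a [b [Ga Gb oab [ra rb] _]]] | [a [c [Ga Gc oac nra]]]].
  have [c] := card_gt0P rb; rewrite inE => /andP[Gc /eqP defb].
  exists a, c; split; rewrite ?defb // => g Gg; apply/negP=> ga.
  by have /setP/(_ g) := cards0_eq ra; rewrite !inE Gg ga.
exists a, (c ^+ p); split; rewrite ?groupX //.
  split; last by apply/card_gt0P; exists c; rewrite !inE Gc eqxx.
  apply/eqP; rewrite cards_eq0; apply/eqP/setP=> g; rewrite !inE.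
  by apply/negP=> /andP[/nra/negP].
suff nroots1 l x : 1 < l < p -> x \in G -> nroots G l x = 1%N.
  by move=> l lp _; rewrite !nroots1 ?groupX.
case/andP=> l_gt1 l_ltp Gx.
have coGl : coprime #|G| l.
  apply: (pnat_coprime pG); rewrite p'natE // gtnNdvd //.
  exact: leq_trans l_gt1.
have [g Gg ->] : exists2 g, g \in G & x = g ^+ l.
  exists (x ^+ expg_invn G l); first exact: groupX.
  by rewrite expgAC (expgK coGl).
apply/eqP/cards1P; exists g; apply/setP=> h; rewrite !inE.
apply/andP/eqP=> [[Gh /eqP ehg]|-> //].
by rewrite -(expgK coGl Gh) -(expgK coGl Gg) /= ehg.
Qed.

Lemma prodX (aT bT : finGroupType) (u : aT * bT) n :
  u ^+ n = (u.1 ^+ n, u.2 ^+ n).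
Proof. by elim: n => [|n IHn] //; rewrite !expgS IHn. Qed.

(** Padding a witness pair of one factor with 1 keeps the orders, and a p-th root in the product
    projects to one in that factor. *)
Lemma satisfiesP_setX (aT bT : finGroupType) (A : {group aT}) (B : {group bT}) :
    p.-group A -> p.-group B -> satisfiesP A p \/ satisfiesP B p ->
  satisfiesP (setX_group A B) p.
Proof.
move=> pA pB PAB; have pAB : p.-group (setX_group A B).
  by rewrite /pgroup cardsX pnatM; apply/andP.
apply/(satisfiesP_iff pAB).
case: PAB => [/(satisfiesP_iff pA) | /(satisfiesP_iff pB)].
  case=> a [c [Aa Ac oac nra]]; exists (a, 1), (c, 1); split.
  - by rewrite !inE Aa group1.
  - by rewrite !inE Ac group1.
  - have o1 x : #[(x, 1) : aT * bT] = #[x].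
      by rewrite -(order_injm (injm_pairg1 aT bT)) ?inE.
    by rewrite prodX expg1n !o1.
  case=> g h; rewrite !inE => /andP[Ag _]; rewrite prodX xpair_eqE /= negb_and.
  by rewrite nra.
case=> a [c [Ba Bc oac nra]]; exists (1, a), (1, c); split.
- by rewrite !inE Ba group1.
- by rewrite !inE Bc group1.
- have o1 x : #[(1, x) : aT * bT] = #[x].
    by rewrite -(order_injm (injm_pair1g aT bT)) ?inE.
  by rewrite prodX expg1n !o1.
case=> g h; rewrite !inE => /andP[_ Bh]; rewrite prodX xpair_eqE /= negb_and.
by rewrite nra ?orbT.
Qed.

Section Group.

Variables (gT : finGroupType) (G : {group gT}).
Hypothesis pG : p.-group G.

Lemma p_order (x : gT) : x \in G -> {k | #[x] = (p ^ k)%N}.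
Proof. by move=> Gx; apply: p_natP; apply: (mem_p_elt pG). Qed.

(* An uncovered element of maximal order is not a p-th power, whereas a power of
   an element of order exponent G has the same order and is one. *)
Lemma satisfiesP_or_covered :
  satisfiesP G p \/
  {in G, forall y, exists z, [/\ z \in G, y \in <[z]> & #[z] = exponent G]}.
Proof.
pose cov y := [exists z in G, (y \in <[z]>) && (#[z] == exponent G)].
have [/forall_inP allG|/forall_inPn[y0 Gy0 ncov0]] :=
    boolP [forall y in G, cov y].
  right=> y /allG/exists_inP[z Gz /andP[yz /eqP oz]].
  by exists z.
left; apply/(satisfiesP_iff pG).
have [x Gx ex] := exponent_witness (pgroup_nil pG).
have [|y /andP[Gy ncov] maxy] :=
    @arg_maxnP _ y0 (fun y => (y \in G) && ~~ cov y) order.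
  by rewrite Gy0.
have nty : y != 1.
  apply: contraNneq ncov => ->; apply/exists_inP.
  by exists x; rewrite // group1 ex /=.
(* A p-th root [g] of [y] has order [p * #[y]], hence is covered by maximality of [y], and then so
   is its power [y]. *)
have noroot : {in G, forall g, g ^+ p != y}.
  move=> g Gg; apply/eqP=> gy.
  have covg : cov g.
    apply: contraT => ncg; have := maxy g; rewrite Gg ncg => /(_ isT).
    rewrite (orderXprime (congr1 order gy)) //.
      by rewrite /= leqNgt ltn_Pmull ?prime_gt1 ?order_gt0.
    have [k oy] := p_order Gy.
    move: nty; rewrite -order_gt1 oy.
    by case: k {oy} => // k; rewrite expnS dvdn_mulr.
  case/exists_inP: covg => z Gz /andP[gz oz]; case/negP: ncov.
  by apply/exists_inP; exists z => //; rewrite oz -gy groupX.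
have [k oy] := p_order Gy; have [e ox] := p_order Gx.
have lt_ke : k < e.
  rewrite ltnNge; apply: contra ncov => le_ek; apply/exists_inP; exists y => //.
  by rewrite cycle_id /= eqn_dvd dvdn_exponent //= ex oy ox dvdn_exp2l.
(* The predecessor leaves one factor p for the final p-th power, [x ^+ (p ^ (e - k))], of order
   [p ^ k]. *)
exists y, (x ^+ (p ^ (e - k).-1)); split; rewrite ?groupX //.
rewrite -expgM -expnSr prednK ?subn_gt0 // (orderXexp _ ox) oy.
by rewrite subKn // ltnW.
Qed.

(** A cyclic group has only one subgroup of each order. *)
Lemma cycle_order_p_eq (z x y : gT) :
  x \in <[z]> -> y \in <[z]> -> #[x] = p -> #[y] = p -> <[x]> = <[y]>.
Proof.
move=> xz yz ox oy; apply/eqP.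
by rewrite (eq_subG_cyclic (cycle_cyclic z)) ?cycle_subG // -!orderE ox oy.
Qed.

(* The only non-abelian p-groups with a unique subgroup of order p are the
   generalised quaternion groups; beyond order 8, their non-central elements
   of order 4 lie in no larger cyclic subgroup. *)
Lemma satisfiesP_unique_order_p (alpha : gT) :
    ~~ abelian G -> ~~ (G \isog [set: 'Q_8]) -> alpha \in G -> #[alpha] = p ->
    {in G, forall y, #[y] = p -> y \in <[alpha]>} ->
  satisfiesP G p.
Proof.
move=> nabG nQ8 Ga oa unip.
have ntG : G :!=: 1 by apply: contraNneq nabG => ->; apply: abelian1.
have o1 : #|'Ohm_1(G)| = p.
  rewrite Ohm1Eprime -oa orderE; congr #|pred_of_set _|.
  apply/eqP; rewrite eqEsubset gen_subG cycle_subG mem_gen ?inE ?Ga ?oa // andbT.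
  apply/subsetP=> y; rewrite inE => /andP[Gy]; have [k oy] := p_order Gy.
  rewrite oy; case: k oy => [|[|k]] oy; first by rewrite expn0.
    by move=> _; apply: unip.
  case/primeP=> _ /(_ p); rewrite expnS dvdn_mulr // => /(_ isT).
  rewrite -expnS -{2}(expn1 p) eqn_exp2l ?prime_gt1 // orbF => /eqP p1.
  by move: p_pr; rewrite p1.
case/(prime_Ohm1P pG ntG)/orP: o1 => [/cyclic_abelian|].
  by rewrite (negPf nabG).
case/andP=> /eqP p2 /eqP/quaternion_classP[n n_gt2 isoG].
have n_gt3 : 3 < n.
  rewrite ltn_neqAle n_gt2 andbT; apply: contraNneq nQ8 => n3.
  by rewrite -n3 in isoG.
have [[x y] genxy _] := generators_quaternion n_gt2 isoG.
have [_ Gx ox /setDP[Gy nXy]] := genxy.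
have [[_ oGX _] _ _ _ _] := quaternion_structure n_gt2 genxy isoG.
have [//|/(_ y Gy)[z [Gz yz oz]]] := satisfiesP_or_covered.
(* Since [y] is outside [<[x]>], so is [z]; thus [z] has order 4, while [#[x]] is at least 8. *)
have: #[x] %| #[z] by rewrite oz dvdn_exponent.
rewrite (oGX z) ?ox; last first.
  rewrite inE Gz andbT; apply: contra nXy => zx.
  by move: yz; apply: subsetP; rewrite cycle_subG.
rewrite -[4]/(2 ^ 2)%N dvdn_Pexp2l //.
by case: n n_gt3 {isoG genxy oGX ox n_gt2} => [|[|[|[|n]]]].
Qed.

Lemma satisfiesP_large_cyclic (m n : nat) :
    ~~ abelian G -> ~~ (G \isog [set: 'Q_8]) -> n < m ->
    #|G| = (p ^ (m + n))%N -> (exists2 x : gT, x \in G & #[x] = (p ^ m)%N) ->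
  satisfiesP G p.
Proof.
move=> nabG nQ8 lt_nm oG [x0 Gx0 ox0].
have [//|cov] := satisfiesP_or_covered.
have [w Gw ew] := exponent_witness (pgroup_nil pG).
have le_mw : (p ^ m <= #[w])%N.
  by rewrite -ox0 -ew dvdn_leq ?exponent_gt0 ?dvdn_exponent.
have meet z : z \in G -> #[z] = #[w] ->
    exists2 b, b \in <[z]> :&: <[w]> & #[b] = p.
  move=> Gz oz; suff: <[z]> :&: <[w]> != 1.
    have pI : p.-group (<[z]> :&: <[w]>).
      by apply: pgroupS pG; rewrite subIset ?cycle_subG ?Gz.
    by case/(pgroup_pdiv pI)=> _ /(Cauchy p_pr)[b Ib ob] _; exists b.
  (* A trivial intersection would give a product set of at least [p ^ (m + m)] elements, more than
     [#|G|]. *)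
  apply/eqP=> /TI_cardMg; rewrite -!orderE oz => ozw.
  have: #|<[z]> * <[w]>| <= #|G| by rewrite subset_leq_card ?mul_subG ?cycle_subG.
  rewrite ozw leqNgt oG; case/negP; apply: leq_trans (leq_mul le_mw le_mw).
  by rewrite -expnD ltn_exp2l ?prime_gt1 // ltn_add2l.
have [a] := meet w Gw erefl; rewrite setIid => wa oa.
have sWG : <[w]> \subset G by rewrite cycle_subG.
apply: (@satisfiesP_unique_order_p a) => // [|y Gy oy]; first exact: (subsetP sWG).
(* Both [<[y]>] and [<[a]>] are the subgroup of order p of [<[z]> :&: <[w]>]. *)
have [z [Gz yz oz]] := cov y Gy.
have [b /setIP[zb wb] ob] := meet z Gz (etrans oz ew).
by rewrite (cycle_order_p_eq wa wb) // -(cycle_order_p_eq yz zb) // cycle_id.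
Qed.

Lemma satisfiesP_or_quotient (alpha : gT) :
    ~~ abelian G -> (exists2 x : gT, x \in G & maxn (p ^ 2) 8 <= #[x]) ->
    alpha \in 'Z(G) -> #[alpha] = p ->
  satisfiesP G p \/ satisfiesP (G / <[alpha]>)%G p.
Proof.
move=> nabG [x Gx]; rewrite geq_max => /andP[x_p2 x_8] Za oa.
have [Ga cGa] := setIP Za.
have nQ8 : ~~ (G \isog [set: 'Q_8]).
  apply: contra nabG => /card_isog; rewrite (@card_quaternion 3) // => oG.
  apply: cyclic_abelian; apply/cyclicP; exists x; apply/eqP.
  by rewrite eq_sym eqEcard cycle_subG Gx oG -orderE.
have [|cov] := satisfiesP_or_covered; first by left.
have [b [Gb ab ob]] := cov alpha Ga.
have [/exists_inP[y Gy /andP[/eqP oy nya]]|allya] :=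
    boolP [exists y in G, (#[y] == exponent G) && (alpha \notin <[y]>)]; last first.
  left; apply: (satisfiesP_unique_order_p nabG nQ8 Ga oa) => y Gy oyp.
  have [z [Gz yz oz]] := cov y Gy.
  move/exists_inPn/(_ z Gz): allya; rewrite oz eqxx negbK => az.
  by rewrite (cycle_order_p_eq az yz) // cycle_id.
right; set H := <[alpha]>.
have nHG : {in G, forall g, g \in 'N(H)}.
  apply/subsetP; rewrite cents_norm // centsC cycle_subG.
  exact: cGa.
have Hp h : h \in H -> h ^+ p = 1.
  by move=> Hh; apply/eqP; rewrite -order_dvdn -oa order_dvdG.
have [e obe] := p_order Gb.
have [f def_e] : exists f, e = f.+2.
  have: p ^ 2 <= p ^ e.
    rewrite -obe ob; apply: leq_trans x_p2 _.
    by rewrite dvdn_leq ?exponent_gt0 ?dvdn_exponent.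
  rewrite leq_exp2l ?(prime_gt1 p_pr) //.
  by case: e {obe} => [|[|f]] // _; exists f.
have oyb : #[y] = #[b] by rewrite oy ob.
have ocos g : g \in G -> forall n, (coset H g ^+ n == 1) = (g ^+ n \in H).
  move=> Gg n; rewrite -morphX ?nHG //.
  apply/eqP/idP; first exact/coset_idr/nHG/groupX.
  exact: coset_id.
have bf : b ^+ (p ^ f.+1) \in H.
  rewrite -cycle_subG (@cycle_order_p_eq b _ alpha) ?groupX ?cycle_id //.
  by rewrite (orderXexp _ obe) def_e subSS subSnn expn1.
have ocb : #[coset H b] = (p ^ f.+1)%N.
  apply/eqP; rewrite eqn_dvd order_dvdn ocos // bf /=.
  rewrite -(@dvdn_pmul2r p) ?prime_gt0 // -expnSr -def_e -obe.
  by rewrite order_dvdn expgM Hp // -ocos // expg_order.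
have ocy : #[coset H y] = (p ^ f.+2)%N.
  rewrite -def_e -obe -oyb; apply/eqP; rewrite eqn_dvd morph_order ?nHG //=.
  rewrite order_dvdn; have: y ^+ #[coset H y] \in H.
    by rewrite -ocos // expg_order.
  (* A nontrivial power of [y] in [H] would generate [H] and put [alpha] in [<[y]>]. *)
  set u := y ^+ _ => Hu; apply: contraR nya => ntu.
  have ou : #[u] = p by apply: nt_prime_order (Hp u Hu) ntu.
  rewrite -cycle_subG (cycle_order_p_eq (cycle_id _) Hu oa ou).
  by rewrite cycle_subG groupX ?cycle_id.
apply/(satisfiesP_iff (quotient_pgroup _ pG)).
exists (coset H b), (coset H y); split; rewrite ?mem_quotient //.
  by rewrite -[p]/(p ^ 1)%N (orderXexp 1 ocy) ocb subn1.
move=> _ /morphimP[w Nw Gw ->]; rewrite -morphX //; apply/eqP=> /kercoset_rcoset.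
case=> [||h Hh wp]; rewrite ?nHG ?groupX //.
(* From [w ^+ p = h * b], where [h] commutes with [b] as [alpha] is in [<[b]>], raising to the power
   [p ^ f.+1], a multiple of p, kills [h] and gives [b ^+ (p ^ f.+1) = 1], against [#[b] = p ^
   f.+2]. *)
have: w ^+ exponent G == 1 by rewrite expg_exponent.
rewrite -ob obe def_e expnS expgM wp expgMn; last first.
  apply: (centsP (cycle_abelian b)); rewrite ?cycle_id //.
  by move: Hh; apply: subsetP; rewrite cycle_subG.
rewrite {1}expnS expgM Hp // expg1n mul1g -order_dvdn obe def_e.
by rewrite dvdn_Pexp2l ?prime_gt1 // ltnn.
Qed.

End Group.

End PrimePower.

Theorem theorem3p15 (p : nat) (gT : finGroupType) (G : {group gT})
    (p_prime : prime p) (pG : p.-group G) (nabG : ~~ abelian G) :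
  (forall m n : nat, (1 <= n)%N -> (n < m)%N ->
     #|G| = (p ^ (m + n))%N ->
     ~~ (G \isog [set: 'Q_8]) ->
     (exists2 x : gT, x \in G & #[x] = (p ^ m)%N) ->
     satisfiesP G p)
  /\
  ((exists2 x : gT, x \in G & (maxn (p ^ 2) 8 <= #[x])%N) ->
   forall alpha : gT, alpha \in 'Z(G) -> #[alpha] = p ->
     (satisfiesP G p \/ satisfiesP (G / <[alpha]>)%G p)
     /\ satisfiesP (setX_group G (G / <[alpha]>)%G) p).
Proof.
split=> [m n _ lt_nm oG nQ8 oX | oX alpha Za oa].
  exact: satisfiesP_large_cyclic oG oX.
have PG := satisfiesP_or_quotient p_prime pG nabG oX Za oa; split=> //.
exact: (satisfiesP_setX p_prime pG (quotient_pgroup _ pG)).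
Qed.
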